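(* Let $h:\mathbb R^d\to\mathbb R$ have curvature in $[a,b]$, let $y\in\mathbb R^d$, $\eta\in[a,b]$, and let $q(x)=h(y)+\langle\nabla h(y),x-y\rangle+\frac\eta2\|x-y\|^2$ be its legacy at anchor $y$. Then for all $x\in\mathbb R^d$, $$\|\nabla q(x)-\nabla h(x)\|\le\max\{b-\eta,\ \eta-a\}\,\|x-y\| .$$ The bound is minimized over $\eta\in[a,b]$ by $\eta^\star=\frac{a+b}2$, for which the constant $\max\{b-\eta,\eta-a\}$ equals the curvature spread $\omega=\frac{b-a}2$. (If $h$ is $\mu_h$-strongly convex and $L_h$-smooth, i.e. $a=\mu_h$, $b=L_h$, then $\omega=\frac{L_h-\mu_h}{2}$; if $h$ is convex and $L_h$-smooth, i.e. $a=0$, $b=L_h$, then $\omega=\frac{L_h}{2}$.)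
   Context: A differentiable function $h:\mathbb R^d\to\mathbb R$ has curvature in $[a,b]$ ($a\le b$ real) if $h-\frac a2\|\cdot\|^2$ is convex and $h-\frac b2\|\cdot\|^2$ is concave. $\|\cdot\|$ is the Euclidean norm. *)

(* Defs.v *)
From mathcomp Require Import all_boot all_order all_algebra.
From mathcomp Require Import all_classical all_reals all_analysis.

Set Implicit Arguments.
Unset Strict Implicit.
Unset Printing Implicit Defensive.

Import Order.TTheory GRing.Theory Num.Theory.
Import numFieldNormedType.Exports.

Local Open Scope classical_set_scope.
Local Open Scope ring_scope.

(* R^d is 'rV[R]_d.  The norm `|x| on matrices is the sup norm, hence the
   separate Euclidean norm; the two induce the same topology, so
   differentiability with respect to `|x| is the usual one. *)

Definition inner (R : realType) (d : nat) (u v : 'rV[R]_d) : R :=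
  \sum_(j < d) u 0 j * v 0 j.

Definition enorm (R : realType) (d : nat) (u : 'rV[R]_d) : R :=
  Num.sqrt (inner u u).

Definition gradient (R : realType) (d : nat) (h : 'rV[R]_d -> R)
    (x : 'rV[R]_d) : 'rV[R]_d :=
  \row_(j < d) 'D_(delta_mx 0 j) h x.

Definition differentiable_everywhere (R : realType) (d : nat)
    (h : 'rV[R]_d -> R) : Prop :=
  forall x : 'rV[R]_d, differentiable h x.

Definition convex_on_space (R : realType) (d : nat) (h : 'rV[R]_d -> R) : Prop :=
  convex_function [set: convex_lmodType 'rV[R]_d] h.

Definition concave_on_space (R : realType) (d : nat) (h : 'rV[R]_d -> R) : Prop :=
  convex_on_space (fun x => - h x).

Definition has_curvature (R : realType) (d : nat) (a b : R)
    (h : 'rV[R]_d -> R) : Prop :=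
  [/\ a <= b,
      differentiable_everywhere h,
      convex_on_space (fun x => h x - a / 2 * enorm x ^+ 2) &
      concave_on_space (fun x => h x - b / 2 * enorm x ^+ 2)].

Definition curvature_spread (R : realType) (a b : R) : R := (b - a) / 2.

Definition legacy (R : realType) (d : nat) (h : 'rV[R]_d -> R)
    (y : 'rV[R]_d) (eta : R) (x : 'rV[R]_d) : R :=
  h y + inner (gradient h y) (x - y) + eta / 2 * enorm (x - y) ^+ 2.

Definition legacy_constant (R : realType) (a b eta : R) : R :=
  Num.max (b - eta) (eta - a).

Definition strongly_convex (R : realType) (d : nat) (mu : R)
    (h : 'rV[R]_d -> R) : Prop :=
  0 < mu /\ convex_on_space (fun x => h x - mu / 2 * enorm x ^+ 2).

Definition smooth (R : realType) (d : nat) (L : R) (h : 'rV[R]_d -> R) : Prop :=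
  [/\ 0 <= L,
      differentiable_everywhere h &
      forall x z : 'rV[R]_d,
        enorm (gradient h x - gradient h z) <= L * enorm (x - z)].

(* Main.v *)
(* Write g = h - eta/2 |.|^2 and M = max(b - eta, eta - a).  The curvature
   hypotheses bound the remainder of the first-order expansion of g at any point
   by M/2 |u|^2 in absolute value, and such a two-sided bound makes the gradient
   of g M-Lipschitz; finally the gradient of the legacy minus that of h at x is
   grad g(y) - grad g(x).  Conversely, if grad h is L-Lipschitz then, by
   Cauchy-Schwarz, the derivative of h - L/2 |.|^2 along every line is
   nonincreasing, which gives the upper curvature bound L. *)
Require Import Defs.
From mathcomp Require Import all_boot all_order all_algebra.
From mathcomp Require Import all_classical all_reals all_analysis.
From mathcomp Require Import ring lra.
Import Order.TTheory GRing.Theory Num.Theory.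
Import numFieldNormedType.Exports.
Local Open Scope ring_scope.
Set Implicit Arguments.
Unset Strict Implicit.

(** * Euclidean inner product and norm *)

Section inner.
Context (R : realType) (d : nat).
Implicit Types (u v w : 'rV[R]_d) (c : R).

Lemma innerC u v : inner u v = inner v u.
Proof. by apply: eq_bigr => j _; rewrite mulrC. Qed.

Lemma innerDl u v w : inner (u + v) w = inner u w + inner v w.
Proof. by rewrite -big_split; apply: eq_bigr => j _; rewrite mxE mulrDl. Qed.

Lemma innerZl c u v : inner (c *: u) v = c * inner u v.
Proof. by rewrite mulr_sumr; apply: eq_bigr => j _; rewrite mxE mulrA. Qed.

Lemma innerNl u v : inner (- u) v = - inner u v.
Proof. by rewrite -scaleN1r innerZl mulN1r. Qed.

Lemma innerDr u v w : inner u (v + w) = inner u v + inner u w.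
Proof. by rewrite !(innerC u) innerDl. Qed.

Lemma innerZr c u v : inner u (c *: v) = c * inner u v.
Proof. by rewrite !(innerC u) innerZl. Qed.

Lemma innerNr u v : inner u (- v) = - inner u v.
Proof. by rewrite !(innerC u) innerNl. Qed.

Definition innerE :=
  (innerDl, innerDr, innerNl, innerNr, innerZl, innerZr).

Lemma inner_ge0 u : 0 <= inner u u.
Proof. by apply: sumr_ge0 => j _; rewrite -expr2 sqr_ge0. Qed.

Lemma inner_eq0 u : inner u u = 0 -> u = 0.
Proof.
move=> /eqP; rewrite psumr_eq0 => [/allP u0|j _]; last by rewrite -expr2 sqr_ge0.
by apply/rowP => j; have := u0 j (mem_index_enum j); rewrite mulf_eq0 orbb mxE => /eqP.
Qed.

Lemma inner_deltar u j : inner u (delta_mx 0 j) = u 0 j.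
Proof.
rewrite /inner (bigD1 j)//= mxE !eqxx mulr1 big1 ?addr0// => i /negbTE ij.
by rewrite mxE ij andbF mulr0.
Qed.

Lemma sqr_enorm u : enorm u ^+ 2 = inner u u.
Proof. by rewrite sqr_sqrtr// inner_ge0. Qed.

Lemma enormZ c u : enorm (c *: u) = `|c| * enorm u.
Proof. by rewrite /enorm !innerE mulrA -expr2 sqrtrM ?sqr_ge0// sqrtr_sqr. Qed.

Lemma enorm_ge0 u : 0 <= enorm u.
Proof. exact: sqrtr_ge0. Qed.

Lemma inner_le_enorm u v : inner u v <= enorm u * enorm v.
Proof.
have [->|u0] := eqVneq u 0.
  by rewrite -(scale0r 0) innerZl mul0r mulr_ge0 ?enorm_ge0.
have uu0 : 0 < inner u u.
  by rewrite lt_def inner_ge0 andbT; apply: contra_neq u0; exact: inner_eq0.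
rewrite (le_trans (ler_norm _))// -ler_sqr ?nnegrE ?mulr_ge0 ?enorm_ge0//.
rewrite real_normK ?num_real// exprMn !sqr_enorm.
(* Expanded, this squared norm is [inner u u] times the Cauchy-Schwarz defect, and [inner u u] is
   positive here. *)
have := inner_ge0 (inner u u *: v - inner u v *: u).
rewrite !innerE (innerC v u) => p.
have : 0 <= inner u u * (inner u u * inner v v - inner u v ^+ 2) by nra.
by rewrite pmulr_rge0// subr_ge0.
Qed.

End inner.

(** * Directional derivatives and gradients *)

Section gradient.
Context (R : realType) (d : nat).
Implicit Types (h : 'rV[R]_d -> R) (x y u v : 'rV[R]_d) (c : R).

Lemma derive_inner h x u : differentiable h x ->
  'D_u h x = inner (gradient h x) u.
Proof.
move=> dh; rewrite deriveE// [u in LHS]row_sum_delta linear_sum /=.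
apply: eq_bigr => j _; rewrite linearZ /= mxE deriveE// mulrC//.
Qed.

Lemma gradientN h x : differentiable h x ->
  gradient (fun z => - h z) x = - gradient h x.
Proof.
by move=> dh; apply/rowP => j; rewrite !mxE deriveN//; exact: diff_derivable.
Qed.

(** For [t != 0] the difference quotient is exactly [c + t * c']; this yields the gradient of the
    legacy straight from its expansion. *)
Lemma derive_quadratic h x u c c' :
  (forall t, h (x + t *: u) = h x + t * c + t ^+ 2 * c') -> 'D_u h x = c.
Proof.
move=> hE; apply/cvg_lim => //.
have cvg_c : ((c + t * c') @[t --> 0^'] --> c)%classic.
  rewrite -[X in (_ --> X)%classic]addr0 -[X in c + X](mul0r c').
  apply: cvgD; first exact: cvg_cst.
  by apply: cvgMr_tmp; exact: nbhs_dnbhs.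
apply: cvg_trans cvg_c; apply: near_eq_cvg; near=> t.
have t0 : t != 0 by near: t; exact: nbhs_dnbhs_neq.
by rewrite /= (addrC _ x) hE /GRing.scale /=; field.
Unshelve. all: by end_near. Qed.

Lemma is_derive_line h x u (s : R) : differentiable h (x + s *: u) ->
  is_derive s 1 (fun s : R => h (x + s *: u)) (inner (gradient h (x + s *: u)) u).
Proof.
move=> dh.
(* The quotient of the one-variable restriction at [s] is that of [h] at [x + s *: u] in direction
   [u]. *)
have E : (fun t : R => t^-1 *: (((fun s : R => h (x + s *: u)) \o shift s) (t *: 1) - h (x + s *: u)))
  = (fun t : R => t^-1 *: ((h \o shift (x + s *: u)) (t *: u) - h (x + s *: u))).
  apply/funext => t /=; congr (_ *: (h _ - _)).
  by rewrite [t *: 1]mulr1 scalerDl addrCA.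
apply: DeriveDef.
  by rewrite /derivable E; exact: diff_derivable.
by rewrite -derive_inner// /derive E.
Qed.

(** * Convexity, quadratic bounds and Lipschitz gradients *)

Lemma convex_on_spaceP h : convex_on_space h <->
  forall x u (t : R), 0 <= t <= 1 ->
    h (x + t *: u) <= t * h (x + u) + (1 - t) * h x.
Proof.
have convE (t : R) x y : t *: y + (1 - t) *: x = x + t *: (y - x).
  by apply/rowP => j; rewrite !mxE; ring.
split=> [hc x u t /andP[t0 t1]|hc t y x _ _].
  have := hc (Itv01 t0 t1) (x + u) x.
  rewrite !inE => /(_ I I).
  by rewrite /conv /= /unstable.onem /= convE (addrC x u) addrK.
have t01 : (0 : R) <= t%:num <= 1 by apply/andP.
have := hc x (y - x) t%:num t01.
by rewrite -convE (addrC x) subrK.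
Qed.

(** Convexity at [x + t *: u], divided by [t], bounds the difference quotient by
    [B + t * (c / 2 * inner u u)]; then let [t] tend to 0 from the right. *)
Lemma convex_curvature_ge h c x u : differentiable h x ->
    convex_on_space (fun z => h z - c / 2 * enorm z ^+ 2) ->
  h x + inner (gradient h x) u + c / 2 * inner u u <= h (x + u).
Proof.
move=> dh /convex_on_spaceP hc.
set B := h (x + u) - h x - c / 2 * inner u u.
suff: inner (gradient h x) u <= B by rewrite /B; lra.
have cvg_B : ((B + t * (c / 2 * inner u u)) @[t --> 0^'+] --> B)%classic.
  rewrite -[X in (_ --> X)%classic]addr0 -[X in B + X](mul0r (c / 2 * inner u u)).
  apply: cvgD; first exact: cvg_cst.
  by apply: cvgMr_tmp; exact: cvg_at_right_filter.
have := cvg_dnbhs_at_right (diff_derivable (v := u) dh).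
rewrite -derive_inner//.
move=> /ler_cvg_to /(_ cvg_B); apply; near=> t.
have t0 : 0 < t by near: t; exact: nbhs_right_gt.
have t1 : t <= 1 by near: t; exact: nbhs_right_le.
have t01 : 0 <= t <= 1 by rewrite ltW.
have := hc x u t t01.
rewrite !sqr_enorm !innerE (innerC u x) /= (addrC _ x) => hct.
rewrite /GRing.scale/= -(ler_pM2l t0) mulVKf ?gt_eqF// /B.
nra.
Unshelve. all: by end_near. Qed.

Lemma concave_curvature_le h c x u : differentiable h x ->
    concave_on_space (fun z => h z - c / 2 * enorm z ^+ 2) ->
  h (x + u) <= h x + inner (gradient h x) u + c / 2 * inner u u.
Proof.
move=> dh hc.
have := @convex_curvature_ge (fun z => - h z) (- c) x u (differentiableN dh).
rewrite gradientN// innerNl => hN.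
suff : - h x - inner (gradient h x) u + - c / 2 * inner u u <= - h (x + u) by lra.
apply: hN; rewrite [X in convex_on_space X](_ : _ = (fun z => - (h z - c / 2 * enorm z ^+ 2)))//.
by apply/funext => z; lra.
Qed.

(* Comparing the two-sided quadratic bounds at [x] and at [y] in the two points
   [(x + y) / 2 +/- s], with [s] parallel to [G x - G y] and
   [2 * enorm s = enorm (x - y)]. *)
Lemma quadratic_bounds_lipschitz (f : 'rV[R]_d -> R) (G : 'rV[R]_d -> 'rV[R]_d)
    (M : R) x y : 0 <= M ->
    (forall z u, `|f (z + u) - f z - inner (G z) u| <= M / 2 * inner u u) ->
  enorm (G x - G y) <= M * enorm (x - y).
Proof.
move=> M0 fG.
set p := G x - G y; set v := x - y.
have [v0|v0] := eqVneq (enorm v) 0.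
  have /inner_eq0/eqP : inner v v = 0 by rewrite -sqr_enorm v0 expr0n.
  by rewrite subr_eq0 /p => /eqP ->; rewrite subrr v0 mulr0 -(scale0r 0) enormZ normr0 mul0r.
have [p0|p0] := eqVneq (enorm p) 0; first by rewrite p0 mulr_ge0 ?enorm_ge0.
have xyD w : x + (w - 2^-1 *: v) = y + (w + 2^-1 *: v).
  by apply/rowP => j; rewrite !mxE; field.
(* At midpoint plus [s], take the lower bound from [x] and the upper one from [y]; at midpoint minus
   [s], the reverse. In the sum, the values of [f] and the terms pairing [G x + G y] with [v]
   cancel. *)
have key s : 2 * inner p s <= M / 2 * (4 * inner s s + inner v v).
  have := fG x (s - 2^-1 *: v); have := fG y (s + 2^-1 *: v).
  have := fG x (- s - 2^-1 *: v); have := fG y (- s + 2^-1 *: v).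
  rewrite !xyD /p; clearbody v; rewrite !ler_norml !innerE (innerC v s).
  by move=> /andP[? ?] /andP[? ?] /andP[? ?] /andP[? ?]; lra.
clearbody p v.
(* Among multiples of [p], this length of [s] makes the bound on [enorm p] smallest. *)
have := key ((enorm v / (2 * enorm p)) *: p).
rewrite !innerE -!sqr_enorm.
set P := enorm p; set V := enorm v.
have -> : 2 * (V / (2 * P) * P ^+ 2) = P * V by field.
have -> : 4 * (V / (2 * P) * (V / (2 * P) * P ^+ 2)) = V ^+ 2 by field.
have V0 : 0 < V by rewrite lt_def v0 enorm_ge0.
by move=> PV; rewrite -(ler_pM2r V0); lra.
Qed.

Lemma smooth_concave h L : smooth L h ->
  concave_on_space (fun z => h z - L / 2 * enorm z ^+ 2).
Proof.
move=> [L0 dh lip]; apply/convex_on_spaceP => x u t /andP[t0 t1].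
set K := L / 2 * inner u u.
(* Along the line, [psi] differs from [h - L / 2 * |.|^2] by an affine function of [s], which does
   not affect concavity. *)
pose psi (s : R) := h (x + s *: u) - K * s ^+ 2.
pose dpsi (s : R) := inner (gradient h (x + s *: u)) u - K * (2 * s).
have psiP (s : R) : is_derive s 1 psi (dpsi s).
  have := is_derive_line (dh (x + s *: u)) => ?.
  apply: is_derive_eq.
  by rewrite /dpsi /GRing.scale /=; ring.
have psi_cont (a b : R) : ({within `[a, b], continuous psi})%classic.
  by apply: derivable_within_continuous => s _; exact: ex_derive.
have [c1 c1t E1] := MVT_segment t0 (fun s _ => psiP s) (psi_cont 0 t).
have [c2 c2t E2] := MVT_segment t1 (fun s _ => psiP s) (psi_cont t 1).
(* From [c1] to [c2] the slope of [h] grows by at most [L * (c2 - c1) * inner u u], which is what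
   the term in [K] subtracts. *)
have dpsi_le : dpsi c2 <= dpsi c1.
  have c12 : c1 <= c2 by move: c1t c2t; rewrite !in_itv /=; lra.
  have := inner_le_enorm (gradient h (x + c2 *: u) - gradient h (x + c1 *: u)) u.
  have := ler_wpM2r (enorm_ge0 u) (lip (x + c2 *: u) (x + c1 *: u)).
  rewrite opprD addrACA subrr add0r -scalerBl.
  rewrite enormZ ger0_norm ?subr_ge0// -!mulrA -expr2 sqr_enorm.
  by rewrite innerDl innerNl /dpsi /K; lra.
move: E1 E2; rewrite /psi scale0r addr0 scale1r !sqr_enorm !innerE (innerC u x).
rewrite /K; move: dpsi_le; set d1 := dpsi c1; set d2 := dpsi c2 => d12 E1 E2.
(* This product is [psi t - (t * psi 1 + (1 - t) * psi 0)]: weight the two mean value identities by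
   [1 - t] and [t] and subtract. *)
have : 0 <= t * (1 - t) * (d1 - d2) by rewrite !mulr_ge0 ?subr_ge0.
nra.
Qed.

End gradient.

(** * The legacy and its gradient error *)

Lemma gradient_legacy (R : realType) (d : nat) (h : 'rV[R]_d -> R) y eta x :
  gradient (legacy h y eta) x = gradient h y + eta *: (x - y).
Proof.
apply/rowP => j; rewrite [LHS]mxE.
apply: (derive_quadratic (c' := eta / 2)) => t.
rewrite /legacy (addrAC x); set v := x - y; clearbody v.
set g := gradient h y; clearbody g.
rewrite !sqr_enorm !innerE (innerC (delta_mx _ _) v) !inner_deltar !mxE !eqxx /=.
by field.
Qed.

Lemma has_curvature_smooth (R : realType) (d : nat) (h : 'rV[R]_d -> R) mu L :
  mu <= L -> convex_on_space (fun z => h z - mu / 2 * enorm z ^+ 2) -> smooth L h ->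
  has_curvature mu L h.
Proof. by move=> muL hmu hL; split=> //; [case: hL|exact: smooth_concave]. Qed.

Theorem lemma1 (R : realType) (d : nat) (h : 'rV[R]_d -> R) :
  (forall a b : R, has_curvature a b h ->
     (forall (y : 'rV[R]_d) (eta : R), a <= eta <= b ->
        forall x : 'rV[R]_d,
          enorm (gradient (legacy h y eta) x - gradient h x)
            <= legacy_constant a b eta * enorm (x - y))
     /\ (let eta_star := (a + b) / 2 in
         [/\ a <= eta_star <= b,
             (forall eta : R, a <= eta <= b ->
                legacy_constant a b eta_star <= legacy_constant a b eta) &
             legacy_constant a b eta_star = curvature_spread a b]))
  /\ (forall mu L : R, (0 < d)%N -> strongly_convex mu h -> smooth L h ->
        has_curvature mu L h /\ curvature_spread mu L = (L - mu) / 2)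
  /\ (forall L : R, convex_on_space h -> smooth L h ->
        has_curvature 0 L h /\ curvature_spread 0 L = L / 2).
Proof.
split=> [a b [ab dh ha hb]|]; first split=> [y eta /andP[aeta etab] x|eta_star].
- set M := legacy_constant a b eta.
  have [bM aM] : b - eta <= M /\ eta - a <= M.
    by rewrite /M /legacy_constant !le_max !lexx orbT.
  have M0 : 0 <= M by rewrite (le_trans _ aM) ?subr_ge0.
  rewrite gradient_legacy.
  have -> : gradient h y + eta *: (x - y) - gradient h x =
      (gradient h y - eta *: y) - (gradient h x - eta *: x).
    by apply/rowP => j; rewrite !mxE; ring.
  rewrite -[x - y]opprB -[- (y - x)]scaleN1r enormZ normrN normr1 mul1r.
  apply: (@quadratic_bounds_lipschitz _ _ (fun z => h z - eta / 2 * inner z z)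
    (fun z => gradient h z - eta *: z)) => // z u.
  (* The remainder of the shifted function at [z] lies between [(a - eta) / 2] and [(b - eta) / 2]
     times [inner u u]. *)
  have lo := convex_curvature_ge u (dh z) ha.
  have hi := concave_curvature_le u (dh z) hb.
  have uu := inner_ge0 u.
  rewrite !innerE (innerC u z) ler_norml; apply/andP; split; nra.
- have eta_starE : legacy_constant a b eta_star = curvature_spread a b.
    rewrite /legacy_constant /curvature_spread /eta_star.
    by rewrite (_ : b - _ = (b - a) / 2) 1?(_ : _ / 2 - a = (b - a) / 2) ?maxxx//; field.
  split=> //; first by rewrite /eta_star; lra.
  move=> eta _; rewrite eta_starE /legacy_constant /curvature_spread le_max.
  by case: (leP eta ((a + b) / 2)) => ?; apply/orP; [left|right]; lra.
split=> [mu L d0 [_ hmu] hL|L h0 hL].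
- split=> //; apply: has_curvature_smooth => //.
  have [_ dh _] := hL.
  (* To get [mu <= L], compare the lower and upper curvature bounds at 0 along a unit vector, which
     exists since [0 < d]. *)
  pose e : 'rV[R]_d := delta_mx 0 (Ordinal d0).
  have ee : inner e e = 1 by rewrite inner_deltar mxE !eqxx.
  have := convex_curvature_ge e (dh 0) hmu.
  have := concave_curvature_le e (dh 0) (smooth_concave hL).
  by rewrite ee; lra.
- split; last by rewrite /curvature_spread subr0.
  apply: has_curvature_smooth => //; first by case: hL.
  by under eq_fun do rewrite mul0r mul0r subr0.
Qed.
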